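(* Let $\mathbb{F}$ be a field with $|\mathbb{F}| \geq 3$, let $A \in M_n(\mathbb{F})$, let $\mathcal{B}$ be a linear subspace of $M_n(\mathbb{F})$ contained in $W_n(\mathbb{F})$, and let $\mathcal{S}=A+\mathcal{B}$. Then $\rho(\mathcal{S}) \geq \mu(G_{\mathcal{S}})$.
   Context: $M_n(\mathbb{F})$ is the space of $n\times n$ matrices over $\mathbb{F}$, and $[n]=\{1,\dots,n\}$. A matrix $A=(A(i,j))$ is weakly symmetric if for all $i,j$: $A(i,j)\neq 0$ iff $A(j,i)\neq 0$; $W_n(\mathbb{F})$ denotes the set of weakly symmetric matrices in $M_n(\mathbb{F})$. For a set $\mathcal{S}$ of matrices, $\rho(\mathcal{S})=\max\{\mathrm{rk}(A): A\in\mathcal{S}\}$. Let $\{(i,j)\in[n]^2: i\le j\}$ be ordered colexicographically: $(i,j)\prec(i',j')$ iff $j<j'$, or $j=j'$ and $i<i'$. For $0\neq A\in W_n(\mathbb{F})$, let $q(A)$ be the $\prec$-maximal pair $(i,j)$ with $i\le j$ and $A(i,j)\neq 0$, and if $q(A)=(i,j)$ set $\tilde q(A)=\{i,j\}$ (a set of size 1 or 2). Let $\tilde K_n=\{e\subset[n]: 0<|e|\le 2\}$ (complete graph with loops). For $\mathcal{S}=A+\mathcal{B}$ with $\mathcal{B}\subset W_n(\mathbb{F})$ a linear space, $G_{\mathcal{S}}=\{\tilde q(B): 0\neq B\in\mathcal{B}\}\subset\tilde K_n$. A matching is a subset $M\subset \tilde K_n$ whose members are pairwise disjoint. For $G\subset\tilde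 K_n$, $\mu(G)=\max\sum_{e\in M}|e|$ over all matchings $M\subset G$. *)

(* Defs.v *)
From HB Require Import structures.
From mathcomp Require Import all_boot all_order all_algebra.
From mathcomp Require Import boolp.

Set Implicit Arguments.
Unset Strict Implicit.
Unset Printing Implicit Defensive.

Import Order.TTheory GRing.Theory.

Local Open Scope ring_scope.

(* The index set [n] = {1, ..., n} is rendered by 'I_n = {0, ..., n - 1}. *)

Section Matrices.
Variables (F : fieldType) (n : nat).
Implicit Types (A : 'M[F]_n) (p r : 'I_n * 'I_n).

Definition weakly_symmetric A : Prop :=
  forall i j : 'I_n, A i j != 0 <-> A j i != 0.

Definition affine_set A (B : {vspace 'M[F]_n}) : 'M[F]_n -> Prop :=
  fun X => exists2 Y, Y \in B & X = A + Y.

(* Ranks of n x n matrices are at most n, so bounding the index k loses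
   nothing; for nonempty S this is the maximum of \rank over S. *)
Definition max_rank (S : 'M[F]_n -> Prop) : nat :=
  (\max_(k < n.+1 | `[< exists2 X, S X & \rank X = k >]) k)%N.

Definition colex_lt p r : bool :=
  (p.2 < r.2)%N || (p.2 == r.2) && (p.1 < r.1)%N.

Definition upper_support A : {set 'I_n * 'I_n} :=
  [set p : 'I_n * 'I_n | (p.1 <= p.2)%N && (A p.1 p.2 != 0)].

(* None only when A vanishes on and above the diagonal; see qmaxP. *)
Definition qmax A : option ('I_n * 'I_n) :=
  [pick p in upper_support A |
     [forall r in upper_support A, (r != p) ==> colex_lt r p]].

Definition qtilde A : {set 'I_n} :=
  if qmax A is Some p then [set p.1; p.2] else set0.

(* G_S for S = A + B; it depends only on the direction space B of S. *)
Definition affine_graph (B : {vspace 'M[F]_n}) : {set {set 'I_n}} :=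
  [set e | `[< exists Y, [/\ Y \in B, Y != 0 & qtilde Y = e] >]].

Lemma qmaxP A : weakly_symmetric A -> A != 0 ->
  exists2 p, qmax A = Some p &
    p \in upper_support A /\
    forall r, r \in upper_support A -> r != p -> colex_lt r p.
Proof.
move=> wsA nzA.
have [p0 p0A] : exists p, p \in upper_support A.
  have [i [j Aij]] : exists i j, A i j != 0.
    apply: contrapT => nA; move/eqP: nzA; apply; apply/matrixP => i j.
    rewrite mxE; apply/eqP/negPn/negP => Aij; apply: nA; by exists i, j.
  have [ij|/ltnW ji] := leqP i j; first by exists (i, j); rewrite inE ij.
  by exists (j, i); rewrite inE ji; apply/wsA.
rewrite /qmax; case: pickP => [p /andP[pA /forall_inP pmax]|none].
  by exists p => //; split=> // r rA; apply/implyP/pmax.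
pose w (p : 'I_n * 'I_n) := (p.2 * n + p.1)%N.
case: (@arg_maxnP _ p0 (mem (upper_support A)) w p0A) => p pA pmax.
have /negP[] := negbT (none p); apply/andP; split=> //.
apply/forall_inP => r rA; apply/implyP => rp.
have := pmax r rA; rewrite /w /colex_lt /geq /= => le_rp.
have [//|lt_pr|eq2] := ltngtP (r.2 : nat) p.2.
- have : (p.2.+1 * n + r.1 <= p.2 * n + p.1)%N.
    by apply: leq_trans le_rp; rewrite leq_add2r leq_mul2r lt_pr orbT.
  rewrite mulSn -addnA addnCA leq_add2l => /(leq_trans (leq_addr _ _)).
  by rewrite leqNgt ltn_ord.
- move: le_rp; rewrite eq2 leq_add2l leq_eqVlt -val_eqE /= eq2 eqxx.
  case/orP=> [/eqP eq1|->//]; case/eqP: rp.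
  by case: r p eq1 eq2 {rA pA pmax} => [r1 r2] [p1 p2] /= /val_inj-> /val_inj->.
Qed.

End Matrices.

Section Graphs.
Variable n : nat.

Definition loop_complete : {set {set 'I_n}} :=
  [set e : {set 'I_n} | (0 < #|e| <= 2)%N].

Definition matching (M : {set {set 'I_n}}) : bool :=
  (M \subset loop_complete) && trivIset M.

Definition mu (G : {set {set 'I_n}}) : nat :=
  (\max_(M : {set {set 'I_n}} | (M \subset G) && matching M)
     \sum_(e in M) #|e|)%N.

End Graphs.

(* Main.v *)
Require Import Defs.
From mathcomp Require Import all_boot all_order all_algebra.
From mathcomp Require Import boolp perm ring zify.

Set Implicit Arguments.
Unset Strict Implicit.
Unset Printing Implicit Defensive.

Import GRing.Theory.

Local Open Scope ring_scope.

(** Let [M] be a matching in the graph, with [Y e] in [B] a matrix whose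
    leading position is [e], and restrict everything to the rows and columns
    in [V = cover M].  The polynomial [det (A + \sum_e x_e Y_e)] has degree at
    most [#|V|], and the monomial [\prod_e x_e ^ #|e|] has degree [#|V|].  Going
    through the indices from the largest down, maximality of the leading
    positions forces every nonzero contribution to this monomial in the Leibniz
    formula to come from the involution exchanging the ends of each edge, so
    its coefficient is nonzero.  Each variable has degree at most 2 there,
    hence (combinatorial Nullstellensatz) the polynomial does not vanish on a
    grid whose sides have three points.  The coefficient is extracted by a
    product of divided differences, so that no polynomials are needed. *)

(** * Coefficient extraction by divided differences *)

Lemma big_option (R : Type) (idx : R) (op : Monoid.com_law idx) (T : finType)
    (f : option T -> R) :
  \big[op/idx]_o f o = op (f None) (\big[op/idx]_e f (Some e)).
Proof.
rewrite (bigD1 None) //=; congr (op _ _).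
rewrite (reindex_omap Some id) => [|[]//].
by apply: eq_bigl => e; rewrite eqxx.
Qed.

Section CoefficientExtraction.
Variable F : fieldType.

(** The weights are those of the divided difference on the first [d + 1] of three points, which
    reads off the coefficient of degree [d] in polynomials of degree at most [d]. *)
Lemma divided_difference (s : seq F) (d : nat) :
    uniq s -> (3 <= size s)%N -> (d <= 2)%N ->
  exists w : {ffun 'I_3 -> F}, forall k, (k <= d)%N ->
    \sum_(i < 3) w i * s`_i ^+ k = (k == d)%:R.
Proof.
move=> us s3 d2.
have nz i j : (i < 3)%N -> (j < 3)%N -> (i != j)%N -> s`_i - s`_j != 0.
  by move=> i3 j3 ij; rewrite subr_eq0 nth_uniq //; apply: leq_trans s3.
have n01 := nz 0%N 1%N isT isT isT; have n02 := nz 0%N 2%N isT isT isT.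
have n12 := nz 1%N 2%N isT isT isT; move: n01 n02 n12 {nz us s3}.
set a := s`_0; set b := s`_1; set c := s`_2 => n01 n02 n12.
case: d d2 => [|[|[|//]]] _.
- exists [ffun i : 'I_3 => [:: 1; 0; 0]`_i] => -[|//] _.
  by rewrite !big_ord_recr big_ord0 !ffunE /= !expr0; ring.
- exists [ffun i : 'I_3 => [:: (a - b)^-1; - (a - b)^-1; 0]`_i].
  move=> [|[|//]] _; rewrite !big_ord_recr big_ord0 !ffunE /= -/a -/b -/c.
    by rewrite !expr0; ring.
  by rewrite !expr1; field.
exists [ffun i : 'I_3 => [:: ((a - b) * (a - c))^-1; - ((a - b) * (b - c))^-1;
                          ((a - c) * (b - c))^-1]`_i].
move=> [|[|[|//]]] _; rewrite !big_ord_recr big_ord0 !ffunE /= -/a -/b -/c.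
- by rewrite !expr0; field; rewrite n12 n02 n01.
- by rewrite !expr1; field; rewrite n12 n02 n01.
- by field; rewrite n12 n02 n01.
Qed.

(** The sum is the coefficient of the monomial with exponents [d e]; [h k] tells which matrix
    supplies the entry of row [k]. All monomials have degree at most [m], so any other one has an
    exponent below some [d e] and is killed by the divided difference in that variable. *)
Lemma det_affine_coef m (T : finType) (d : T -> nat) (s : seq F)
    (A : 'M[F]_m) (C : T -> 'M[F]_m) :
    uniq s -> (3 <= size s)%N -> (forall e, d e <= 2)%N ->
    (\sum_e d e)%N = m ->
    (forall x : T -> F, \det (A + \sum_e x e *: C e) = 0) ->
  \sum_(t : 'S_m) \sum_(h : {ffun 'I_m -> T} |
      [forall e, #|[set k | h k == e]| == d e])
    (-1) ^+ t * \prod_k C (h k) k (t k) = 0.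
Proof.
move=> us s3 d2 dm det0.
have [w wP] := choice (fun e => divided_difference us s3 (d2 e)).
(* [None] marks a row whose entry comes from the constant matrix [A]. *)
pose D o : 'M[F]_m := if o is Some e then C e else A.
pose x (g : {ffun T -> 'I_3}) e := s`_(g e).
pose y g o := if o is Some e then x g e else 1.
have detE g : \det (A + \sum_e x g e *: C e) =
    \sum_(t : 'S_m) \sum_(h : {ffun 'I_m -> option T})
      (-1) ^+ t * \prod_k D (h k) k (t k) *
      \prod_e x g e ^+ #|[set k | h k == Some e]|.
  apply: eq_bigr => t _.
  under [RHS]eq_bigr => h _ do rewrite -mulrA.
  rewrite -big_distrr /=; congr (_ * _).
  transitivity (\prod_k \sum_o y g o * D o k (t k)).
    apply: eq_bigr => k _; rewrite !mxE summxE big_option /= mul1r.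
    by congr (_ + _); apply: eq_bigr => e _; rewrite mxE.
  rewrite bigA_distr_bigA /=; apply: eq_bigr => h _.
  rewrite big_split mulrC; congr (_ * _).
  rewrite (partition_big h predT) //= big_option /=.
  rewrite [X in X * _]big1 ?mul1r => [|k /eqP->//].
  apply: eq_bigr => e _.
  rewrite (eq_bigr (fun=> x g e)) => [|k /eqP->//].
  by rewrite prodr_const; congr (_ ^+ _); apply: eq_card => k; rewrite !inE.
have : \sum_(g : {ffun T -> 'I_3}) (\prod_e w e (g e)) *
    \det (A + \sum_e x g e *: C e) = 0.
  by rewrite big1 // => g _; rewrite det0 mulr0.
under eq_bigr => g _ do rewrite detE big_distrr /=.
rewrite exchange_big /= => E0; rewrite -[RHS]E0; apply: eq_bigr => t _.
under [RHS]eq_bigr => g _ do rewrite big_distrr /=.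
rewrite [RHS]exchange_big /=.
pose a (h : {ffun 'I_m -> option T}) e := #|[set k | h k == Some e]|.
have fiberE (h : {ffun 'I_m -> option T}) :
    (#|[set k | h k == None]| + \sum_e a h e)%N = m.
  rewrite -[RHS]card_ord -[in RHS]sum1_card.
  rewrite (partition_big h predT) //= big_option /=.
  by congr (_ + _)%N; [|apply: eq_bigr => e _]; rewrite sum1_card;
    apply: eq_card => k; rewrite !inE.
have coefE (h : {ffun 'I_m -> option T}) :
    \sum_(g : {ffun T -> 'I_3}) \prod_e w e (g e) *
       ((-1) ^+ t * \prod_k D (h k) k (t k) * \prod_e x g e ^+ a h e) =
    if [forall e, a h e == d e]
    then (-1) ^+ t * \prod_k D (h k) k (t k) else 0.
  transitivity ((-1) ^+ t * \prod_k D (h k) k (t k) *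
                \prod_e \sum_(i < 3) w e i * s`_i ^+ a h e).
    rewrite bigA_distr_bigA /= big_distrr /=; apply: eq_bigr => g _.
    by rewrite big_split /= mulrCA.
  case: ifPn => [/forallP ad|nad].
    rewrite -[RHS]mulr1; congr (_ * _); apply: big1 => e _.
    by rewrite wP (eqP (ad e)) ?eqxx.
  have [/existsP[e lt_e]|] := boolP [exists e, (a h e < d e)%N].
    rewrite (bigD1 e) //= wP 1?ltnW // ltn_eqF //.
    by rewrite mul0r mulr0.
  (* With no exponent below [d e], the degree bound [m] forces equality everywhere, against
     [nad]. *)
  rewrite negb_exists => /forallP ge_d.
  case/negP: nad; apply/forallP => e.
  have le_d e' : (d e' <= a h e')%N by rewrite leqNgt.
  have le_m : (\sum_e a h e <= \sum_e d e)%N.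
    by rewrite dm -[leqRHS](fiberE h) leq_addl.
  have /leqif_sum sum_d e' : predT e' ->
      (d e' <= a h e' ?= iff (d e' == a h e'))%N.
    by move=> _; split.
  have : (\sum_e d e == \sum_e a h e)%N.
    by rewrite eqn_leq le_m leq_sum.
  by rewrite sum_d => /forallP/(_ e); rewrite eq_sym.
under [RHS]eq_bigr => h _ do rewrite coefE.
rewrite -big_mkcond /=.
(* A row index exists only if [m > 0], and then [T] is inhabited. The default is never taken on the
   [h] that are kept: full degree leaves no row for [None]. *)
have dflt (k : 'I_m) : T.
  case: (pickP (fun _ : T => true)) => [e _|no_e]; first exact: e.
  have m0 : m = 0%N by rewrite -dm big1 // => e; rewrite no_e.
  by case: k => k; rewrite m0.
pose lo (h : {ffun 'I_m -> T}) := [ffun k => Some (h k)].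
pose dl (h : {ffun 'I_m -> option T}) := [ffun k => odflt (dflt k) (h k)].
rewrite (reindex_onto lo dl) /= => [|h /forallP ad]; last first.
  apply/ffunP => k; rewrite !ffunE.
  have /eqP : (\sum_e a h e)%N = m.
    by rewrite -[RHS]dm; apply: eq_bigr => e _; apply/eqP.
  rewrite -[X in _ == X](fiberE h) -[X in X == _]add0n eqn_add2r.
  rewrite eq_sym cards_eq0.
  by move/eqP/setP/(_ k); rewrite !inE; case: (h k).
apply: eq_big => [h|h _]; last first.
  by congr (_ * _); apply: eq_bigr => k _; rewrite ffunE.
rewrite (_ : dl (lo h) = h) ?eqxx ?andbT; last first.
  by apply/ffunP => k; rewrite !ffunE.
apply: eq_forallb => e; congr (_ == _); apply: eq_card => k.
by rewrite !inE ffunE.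
Qed.

End CoefficientExtraction.

(** * Uniqueness of the leading term in the Leibniz formula *)

(* [v] is the original index of a row of the submatrix, [b k] the edge of the
   matching through [k], and [p k] its other end ([p k = k] for a loop). *)
Section LeadingTerm.
Variables (F : fieldType) (m : nat) (T : finType).
Variables (v : 'I_m -> nat) (b : 'I_m -> T) (p : 'I_m -> 'I_m).
Variable C : T -> 'M[F]_m.
Hypothesis v_inj : injective v.
Hypothesis b_eq : forall k l, (b l == b k) = (l \in [set k; p k]).
Hypothesis C_lead : forall k, C (b k) k (p k) != 0.
Hypothesis C_supp : forall a k l, (v (p a) <= v a)%N -> C (b a) k l != 0 ->
  [/\ (v k <= v a)%N, (v l <= v a)%N, k = a -> (v l <= v (p a))%N
    & l = a -> (v k <= v (p a))%N].

Lemma block_partner k : b (p k) = b k.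
Proof. by apply/eqP; rewrite b_eq set22. Qed.

Lemma partnerK : involutive p.
Proof.
move=> k; have := b_eq (p k) k; rewrite block_partner eqxx => /esym.
by rewrite in_set2 => /orP[]/eqP // pk; rewrite -!pk.
Qed.

Section Uniqueness.
Variables (t : 'S_m) (h : {ffun 'I_m -> T}).
Hypothesis h_card : forall e, #|[set k | h k == e]| = #|[set k | b k == e]|.
Hypothesis h_supp : forall k, C (h k) k (t k) != 0.

(** [C_supp] applies at upper ends only, so the edge of an entry is named by its upper end. *)
Lemma block_top k : exists2 a, h k = b a & (v (p a) <= v a)%N.
Proof.
have : (0 < #|[set l | b l == h k]|)%N.
  by rewrite -h_card; apply/card_gt0P; exists k; rewrite inE.
case/card_gt0P => a; rewrite inE => /eqP ba.
have [le_a|/ltnW le_a] := leqP (v (p a)) (v a); first by exists a.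
by exists (p a); rewrite ?block_partner ?partnerK.
Qed.

(* At the upper end of an edge one only learns that the two entries meeting [k]
   come from its own edge; that they are the entries in positions [(k, p k)] and
   [(p k, k)] is forced only when the descent reaches the lower end [p k]. *)
Let forced k :=
  if (v (p k) <= v k)%N then
    [/\ h k = b k, h (t^-1%g k) = b k, (v (t k) <= v (p k))%N
      & (v (t^-1%g k) <= v (p k))%N]
  else t k = p k /\ t (p k) = k.

(** The entries in row [k] and in column [k] already exhaust the edge of [k]: if they coincide,
    [forced] makes that edge a loop, which supplies a single entry. *)
Lemma forced_fiber k x : (v (p k) <= v k)%N -> forced k -> h x = b k ->
  x = k \/ t x = k.
Proof.
move=> top; rewrite /forced top => -[hk hl _ vl] hx.
have sub : [set k; t^-1%g k] \subset [set x | h x == b k].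
  by apply/subsetP => y; rewrite !inE => /orP[]/eqP->; apply/eqP.
have le2 : (#|[set x | h x == b k]| <= #|[set k; t^-1%g k]|)%N.
  rewrite h_card (_ : [set _ | _] = [set k; p k]); last first.
    by apply/setP => y; rewrite inE b_eq.
  rewrite !cards2; case: (eqVneq k (t^-1%g k)) => [kl|_];
    last by case: (_ != _).
  rewrite -kl in vl; suff -> : p k = k by rewrite eqxx.
  by apply: v_inj; apply/eqP; rewrite eqn_leq top.
have : x \in [set k; t^-1%g k].
  have /eqP-> : [set k; t^-1%g k] == [set x | h x == b k].
    by rewrite eqEcard sub.
  by rewrite inE hx.
by rewrite !inE => /orP[]/eqP->; [left | right; rewrite permKV].
Qed.

(** For a proper edge, [forced] at the lower end says it all. For a loop, the only entry of the edge
    lies both in row [k] and in column [k]. *)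
Lemma forced_swap k : (v (p k) <= v k)%N -> forced k -> forced (p k) ->
  t k = p k /\ t (p k) = k.
Proof.
move=> top Fk; rewrite {1}/forced partnerK; case: ifPn => [ge|_ [? ?]//].
have pk : p k = k by apply: v_inj; apply/eqP; rewrite eqn_leq top.
move: Fk; rewrite /forced top !pk => -[hk hl _ _] _.
have : #|[set x | h x == b k]| == 1%N.
  rewrite h_card (_ : [set _ | _] = [set k]) ?cards1 //.
  by apply/setP => y; rewrite inE b_eq pk setUid.
case/cards1P => z /setP Ez.
have /eqP kz : k == z by have := Ez k; rewrite !inE hk eqxx => <-.
have /eqP lz : t^-1%g k == z.
  by have := Ez (t^-1%g k); rewrite !inE hl eqxx => <-.
have : t k = k by rewrite -{2}(permKV t k) lz -kz.
by split.
Qed.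

(** By [forced_fiber] the entry sits at [(k, a)] or [(a, k)], so [k] is at most [p a]. If it were
    smaller, [p a] would be settled too, and [forced_swap] would leave no entry of this edge for
    [k]. *)
Lemma forced_above k a x : (forall l, (v k < v l)%N -> forced l) ->
    (v (p a) <= v a)%N -> (v k < v a)%N -> h x = b a -> x = k \/ t x = k ->
  p a = k /\ ((x = k -> t k = a) /\ (t x = k -> t a = k)).
Proof.
move=> IH top lt_ka hx xk; have Fa := IH _ lt_ka.
have ne_ka : k <> a by move=> ka; rewrite ka ltnn in lt_ka.
have := Fa; rewrite /forced top => -[_ _ vta vla].
have x_a := forced_fiber top Fa hx.
have pak : p a = k.
  apply: contrapT => ne_pk.
  have le_k : (v k <= v (p a))%N.
    case: x_a xk => [->|tx] [xk|txk].
    - by case: ne_ka.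
    - by rewrite -txk.
    - by rewrite -xk -(permK t x) tx.
    - by case: ne_ka; rewrite -tx.
  have lt_k : (v k < v (p a))%N.
    by rewrite ltn_neqAle le_k andbT; apply/eqP => /v_inj/esym.
  have [ta tpa] := forced_swap top Fa (IH _ lt_k).
  case: x_a xk => [xa|tx] [xk|txk].
  - by case: ne_ka; rewrite -xa.
  - by case: ne_pk; rewrite -ta -xa.
  - by case: ne_pk; rewrite -xk; apply: (@perm_inj _ t); rewrite tpa.
  - by case: ne_ka; rewrite -tx.
split=> //; case: x_a {xk} => [xa|tx].
  by split=> [xk|<-]; [case: ne_ka; rewrite -xk | rewrite xa].
by split=> [<-//|txk]; case: ne_ka; rewrite -txk.
Qed.

Lemma forcedP k : forced k.
Proof.
(* Downward induction on [v k]. *)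
pose N := (\max_l v l)%N; have leN l : (v l <= N)%N by apply: leq_bigmax.
have [c] := ubnP (N - v k)%N; elim: c k => // c IHc k lt_c.
have IH l : (v k < v l)%N -> forced l.
  by move=> lt_kl; apply: IHc; have := leN l; lia.
have tVk : t (t^-1%g k) = k by rewrite permKV.
rewrite /forced; case: ifPn => [top|]; last first.
  rewrite -ltnNge => lt_kp.
  (* The entries in row [k] and column [k] are treated together. An edge with upper end at most [k]
     would, by [C_supp], have upper end [k], but [k] is a lower end here. *)
  have key x : x = k \/ t x = k ->
      (x = k -> t k = p k) /\ (t x = k -> t (p k) = k).
    move=> xk; have [a hx top] := block_top x.
    have [lt_ka|le_ak] := ltnP (v k) (v a).
      have [<- ?] := forced_above IH top lt_ka hx xk.
      by rewrite partnerK.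
    have := h_supp x; rewrite hx => /(C_supp top)[le1 le2 _ _].
    have ka : k = a.
      by apply: v_inj; apply/eqP; rewrite eqn_leq le_ak andbT; case: xk => <-.
    by move: top; rewrite -ka leqNgt lt_kp.
  split; first by have [/(_ erefl)] := key k (or_introl erefl).
  by have [_ /(_ tVk)] := key (t^-1%g k) (or_intror tVk).
(* Now an edge with upper end above [k] is excluded, since [forced_above] would make [k] a lower
   end. *)
have key x : x = k \/ t x = k -> h x = b k.
  move=> xk; have [a hx topa] := block_top x.
  have [lt_ka|le_ak] := ltnP (v k) (v a).
    have [pak _] := forced_above IH topa lt_ka hx xk.
    by move: lt_ka; rewrite ltnNge -(partnerK a) pak top.
  have := h_supp x; rewrite hx => /(C_supp topa)[le1 le2 _ _].
  have -> // : k = a.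
  by apply: v_inj; apply/eqP; rewrite eqn_leq le_ak andbT; case: xk => <-.
have hk := key k (or_introl erefl); have hl := key _ (or_intror tVk).
split=> //.
  by have := h_supp k; rewrite hk => /(C_supp top)[_ _ /(_ erefl)].
by have := h_supp (t^-1%g k); rewrite hl tVk => /(C_supp top)[_ _ _ /(_ erefl)].
Qed.

Lemma leading_term_unique : (forall k, t k = p k) /\ (forall k, h k = b k).
Proof.
have tp k : t k = p k.
  have [top|/ltnW top] := leqP (v (p k)) (v k).
    by case: (forced_swap top (forcedP k) (forcedP _)).
  rewrite -{1}(partnerK k) in top.
  by have [] := forced_swap top (forcedP _) (forcedP _); rewrite partnerK.
split=> // k; have := forcedP k; rewrite /forced; case: ifPn => [_ []//|].
rewrite -ltnNge => /ltnW top _.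
(* At a lower end [k], row [k] holds the entry of column [p k], whose edge is known from the upper
   end. *)
have := forcedP (p k); rewrite /forced partnerK top.
by case=> _ + _ _; rewrite block_partner -tp permK.
Qed.

End Uniqueness.

(** Only the pair [(t0, h0)] contributes, and its term is a signed product of leading entries. *)
Lemma leading_coef_neq0 :
  \sum_(t : 'S_m) \sum_(h : {ffun 'I_m -> T} |
      [forall e, #|[set k | h k == e]| == #|[set k | b k == e]|])
    (-1) ^+ t * \prod_k C (h k) k (t k) != 0.
Proof.
pose t0 := perm (inv_inj partnerK); pose h0 := [ffun k => b k].
have uniq_term (t : 'S_m) (h : {ffun 'I_m -> T}) :
    [forall e, #|[set k | h k == e]| == #|[set k | b k == e]|] ->
    \prod_k C (h k) k (t k) != 0 -> t = t0 /\ h = h0.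
  move=> /forallP hc /prodf_neq0 nz.
  have [||tp hb] := @leading_term_unique t h; first by move=> e; apply/eqP/hc.
    by move=> k; apply: nz.
  by split; [apply/permP => k; rewrite permE tp
            |apply/ffunP => k; rewrite ffunE hb].
rewrite (bigD1 t0) //= [X in _ + X]big1 ?addr0 => [|t ne_t]; last first.
  apply: big1 => h hc; apply/eqP; rewrite mulf_eq0 signr_eq0 /=.
  by apply: contraNT ne_t => /(uniq_term _ _ hc)[->].
rewrite (bigD1 h0) /=; last first.
  by apply/forallP => e; apply/eqP/eq_card => k; rewrite !inE ffunE.
rewrite [X in _ + X]big1 ?addr0 => [|h /andP[hc ne_h]]; last first.
  apply/eqP; rewrite mulf_eq0 signr_eq0 /=.
  by apply: contraNT ne_h => /(uniq_term _ _ hc)[_ ->].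
rewrite mulf_neq0 ?signr_eq0 //; apply/prodf_neq0 => k _.
by rewrite ffunE permE.
Qed.

End LeadingTerm.

(** * From leading positions to the rank bound *)

(** Colexicographic maximality bounds the support on and above the diagonal; weak symmetry carries
    the bounds below it. *)
Lemma qtilde_lead (F : fieldType) n (Y : 'M[F]_n) (u w : 'I_n) :
    weakly_symmetric Y -> Y != 0 -> qtilde Y = [set u; w] -> (u <= w)%N ->
  Y u w != 0 /\ forall k l, Y k l != 0 ->
    [/\ (k <= w)%N, (l <= w)%N, k = w -> (l <= u)%N & l = w -> (k <= u)%N].
Proof.
move=> wsY nzY + le_uw; have [[i j] qE [pin pmax]] := qmaxP wsY nzY.
rewrite /qtilde qE /= => /setP E.
move: pin; rewrite inE /= => /andP[le_ij Yij].
have [iu jw] : i = u /\ j = w.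
  have := E i; have := E j; have := E u; have := E w.
  rewrite !inE !eqxx ?orbT /= => /orP[]/eqP ? /orP[]/eqP ?; subst=> //.
  - by rewrite orbb => /esym/eqP.
  - by split; apply/val_inj/eqP; rewrite eqn_leq le_ij le_uw.
  - by move=> _ /esym; rewrite orbb => /eqP.
subst i j; split=> //.
have bound (k l : 'I_n) :
    (k <= l)%N -> Y k l != 0 -> (l <= w)%N /\ (l = w -> (k <= u)%N).
  move=> le_kl Ykl.
  have kl : (k, l) \in upper_support Y by rewrite inE /= le_kl.
  have [[-> ->]//|/(pmax _ kl)] := eqVneq (k, l) (u, w).
  rewrite /colex_lt /= => /orP[lt_lw|/andP[/eqP-> /ltnW]//].
  by split=> [|lw]; [exact: ltnW | rewrite lw ltnn in lt_lw].
move=> k l Ykl; have [le_kl|/ltnW le_lk] := leqP k l.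
  have [le_lw le_ku] := bound _ _ le_kl Ykl; split=> //.
    exact: leq_trans le_lw.
  move=> kw; suff lw : l = w by rewrite lw -kw le_ku.
  by apply/val_inj/eqP; rewrite eqn_leq le_lw -kw.
have [le_kw le_lu] := bound _ _ le_lk ((wsY k l).1 Ykl); split=> //.
  exact: leq_trans le_kw.
move=> lw; suff kw : k = w by rewrite kw -lw le_lu.
by apply/val_inj/eqP; rewrite eqn_leq le_kw -lw.
Qed.

Lemma rank_mxsub_le (F : fieldType) m n (f : 'I_m -> 'I_n) (X : 'M[F]_n) :
  (\rank (mxsub f f X) <= \rank X)%N.
Proof.
have sub_rank m1 m2 n1 (g : 'I_m1 -> 'I_m2) (Z : 'M[F]_(m2, n1)) :
    (\rank (rowsub g Z) <= \rank Z)%N.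
  by rewrite rowsubE mxrankM_maxr.
have -> : mxsub f f X = rowsub f (rowsub f X^T)^T.
  by apply/matrixP => i j; rewrite !mxE.
by apply: leq_trans (sub_rank _ _ _ _ _) _; rewrite mxrank_tr -(mxrank_tr X).
Qed.

Theorem theorem1p1 (F : fieldType) (n : nat) (A : 'M[F]_n)
    (B : {vspace 'M[F]_n})
    (cardF : exists s : seq F, uniq s /\ (3 <= size s)%N)
    (BW : forall Y : 'M[F]_n, Y \in B -> weakly_symmetric Y) :
  (max_rank (affine_set A B) >= mu (affine_graph B))%N.
Proof.
case: cardF => s [us s3].
apply/bigmax_leqP => M /andP[/subsetP sMG /andP[_ tM]].
(* Disjointness turns the weight of [M] into [#|V|]. *)
rewrite (eqP tM); set V := cover M.
(* Outside [M] the value 0 keeps [Y e] in [B], so sums may run over all sets [e]. *)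
have /choice[Y YP] (e : {set 'I_n}) : exists Z : 'M[F]_n, Z \in B /\
    (e \in M -> Z != 0 /\ qtilde Z = e).
  have [/sMG|] := boolP (e \in M); last by exists 0; rewrite mem0v.
  by rewrite inE => /asboolP[Z [ZB nzZ qZ]]; exists Z.
have YB e : Y e \in B := (YP e).1.
pose f : 'I_#|V| -> 'I_n := @enum_val _ (mem V).
have fV k : f k \in V := enum_valP k.
have f_inj : injective f := @enum_val_inj _ (mem V).
pose b k := pblock M (f k).
have bM k : b k \in M by apply: pblock_mem; apply: fV.
have nzY k : Y (b k) != 0 by have [] := (YP (b k)).2 (bM k).
have qY k : qtilde (Y (b k)) = b k by have [] := (YP (b k)).2 (bM k).
have wsY k : weakly_symmetric (Y (b k)) := BW _ (YB (b k)).
have /choice[p pE] k : exists l, b k = [set f k; f l].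
  have [[i j] qE _] := qmaxP (wsY k) (nzY k).
  have bE : b k = [set i; j] by rewrite -qY /qtilde qE.
  have inV x : x \in b k -> exists l, x = f l.
    move=> xb; have xV : x \in V by apply/bigcupP; exists (b k).
    by exists (enum_rank_in xV x); rewrite /f enum_rankK_in.
  have : f k \in b k by rewrite mem_pblock; apply: fV.
  rewrite {1}bE in_set2 => /orP[]/eqP fk.
    by have [|l jl] := inV j; [rewrite bE set22 | exists l; rewrite bE fk jl].
  by have [|l il] := inV i; [rewrite bE set21|exists l; rewrite bE fk il setUC].
have b_eq k l : (b l == b k) = (l \in [set k; p k]).
  rewrite in_set2 -!(inj_eq f_inj) -in_set2 -pE.
  by rewrite eq_sym eq_pblock //; apply: fV.
have b_p k : b (p k) = b k by apply/eqP; rewrite b_eq set22.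
have p_p k : p (p k) = k := partnerK b_eq k.
pose v k : nat := f k; pose C e := mxsub f f (Y e).
have lead k : (v (p k) <= v k)%N -> Y (b k) (f (p k)) (f k) != 0 /\
  forall i j, Y (b k) i j != 0 -> [/\ (i <= f k)%N, (j <= f k)%N,
    i = f k -> (j <= f (p k))%N & j = f k -> (i <= f (p k))%N].
  by move=> top; apply: qtilde_lead => //; rewrite qY pE setUC.
have C_lead k : C (b k) k (p k) != 0.
  (* [lead] gives the entry above the diagonal; when [k] is the upper end, weak symmetry transposes
     it. *)
  rewrite mxE; have [/lead[/wsY]//|/ltnW] := leqP (v (p k)) (v k).
  by rewrite -{1}(p_p k) => /lead[]; rewrite b_p p_p.
have nz : exists x : {set 'I_n} -> F,
    \det (mxsub f f A + \sum_e x e *: C e) != 0.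
  apply: contrapT => none.
  have v_inj : injective v by move=> k l /val_inj/f_inj.
  have C_supp a k l : (v (p a) <= v a)%N -> C (b a) k l != 0 ->
      [/\ (v k <= v a)%N, (v l <= v a)%N, k = a -> (v l <= v (p a))%N
        & l = a -> (v k <= v (p a))%N].
    move=> top; rewrite mxE => /((lead a top).2)[? ? ka la].
    by split=> // e; [apply: ka | apply: la]; rewrite e.
  apply: (negP (leading_coef_neq0 v_inj b_eq C_lead C_supp)).
  apply/eqP/(det_affine_coef us s3 (A := mxsub f f A)) => [e||x].
  - have [->|] := set_0Vmem [set k | b k == e]; first by rewrite cards0.
    case=> k; rewrite inE => /eqP <-.
    by rewrite (_ : [set _ | _] = [set k; p k]) ?cards2 ?leq_b1 //;
      [case: (_ != _) | apply/setP => l; rewrite inE b_eq].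
  - transitivity (\sum_(k < #|V|) 1)%N; last by rewrite sum1_card card_ord.
    rewrite (partition_big b predT) //=.
    by apply: eq_bigr => e _; rewrite sum1dep_card.
  - by apply/eqP/negPn/negP => nz; apply: none; exists x.
have [x] := nz; set X := A + \sum_e x e *: Y e.
have -> : mxsub f f A + \sum_e x e *: C e = mxsub f f X.
  apply/matrixP => i j; rewrite !mxE !summxE.
  by congr (_ + _); apply: eq_bigr => e _; rewrite !mxE.
(* The submatrix of [X] on [V] is invertible, so [X] has rank at least [#|V|]. *)
rewrite -unitfE -[_ \is a _]/(_ \in unitmx) -row_free_unit => /eqP rk.
apply: leq_trans (_ : \rank X <= _)%N; first by rewrite -{1}rk rank_mxsub_le.
have ltX : (\rank X < n.+1)%N by rewrite ltnS rank_leq_row.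
rewrite -[leqLHS]/(nat_of_ord (Ordinal ltX)); apply: leq_bigmax_cond.
apply/asboolP; exists X => //; exists (\sum_e x e *: Y e) => //.
by apply: memv_suml => e _; apply: memvZ.
Qed.
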